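(* Let $\mathcal{A}$ be a finite set with $k\geq 2$ elements and let $\Sigma=\mathcal{A}^{\mathbb{Z}}$. Let $\varphi:\mathbb{N}_0\to[0,\infty)$ be a non-decreasing function such that $$\lim_{l\to\infty}\frac{1}{l}\ln(\varphi(l))\leq\delta\ln(k)$$ for some $0<\delta<1$. Then there exist $l_0=l_0(\varphi,k,\delta)\in\mathbb{N}_0$ and a word $w\in\Sigma$ such that for every $l\in\mathbb{N}_0$ with $l\geq l_0$ we have $R_w(l)\geq\varphi(l)$.
   Context: $\mathbb{N}_0$ denotes the natural numbers including $0$ and $\mathbb{N}=\mathbb{N}_0\setminus\{0\}$. Elements of $\Sigma$ (biinfinite sequences $w:\mathbb{Z}\to\mathcal{A}$) are called words. For $w\in\Sigma$, $i\in\mathbb{Z}$, $l\in\mathbb{N}_0$, $[w(i)\ldots w(i+l)]$ denotes the subword of $w$ consisting of the $l+1$ letters at positions $i,\ldots,i+l$. The recurrence time of $w$ at time $i\in\mathbb{Z}$ is the function $R_w^i:\mathbb{N}_0\to\mathbb{N}\cup\{\infty\}$, $$R_w^i(l)=\min\{s\geq 1: [w(i+s)\ldots w(i+s+l)]=[w(i)\ldots w(i+l)]\}$$ ($=\infty$ if there is no such $s$), and $R_w(l):=\min\{R_w^i(l): i\in\mathbb{Z}\}$. Convention: $\ln 0=-\infty$. *)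

(* Defs.v *)
From HB Require Import structures.
From mathcomp Require Import all_boot all_order all_algebra.
From mathcomp Require Import all_classical all_reals all_analysis.

Set Implicit Arguments.
Unset Strict Implicit.
Unset Printing Implicit Defensive.

Import Order.TTheory GRing.Theory Num.Theory.
Import numFieldNormedType.Exports.

Local Open Scope classical_set_scope.
Local Open Scope ring_scope.

(* N U {oo}, with None standing for oo. *)
Definition enat : Type := option nat.

(* The minimum of a set of elements of N U {oo}; it is oo when the set has no
   finite element, in particular when it is empty. *)
Definition enat_min (S : set enat) : enat :=
  if pselect (exists n : nat, `[< S (Some n) >]) is left exS
  then Some (ex_minn exS) else None.

Definition enat_ereal (R : realType) (s : enat) : \bar R :=
  if s is Some n then n%:R%:E else +oo%E.

Definition word (A : finType) : Type := int -> A.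

(* [w(i) ... w(i+l)], which has l + 1 letters. *)
Definition subword (A : finType) (w : word A) (i : int) (l : nat) :
    l.+1.-tuple A :=
  [tuple w (i + (j : nat)%:Z) | j < l.+1].

Definition recurrence_time_at (A : finType) (w : word A) (i : int) (l : nat) :
    enat :=
  enat_min [set Some s | s in
    [set s : nat | (1 <= s)%N /\ subword w (i + s%:Z) l = subword w i l]].

Definition recurrence_time (A : finType) (w : word A) (l : nat) : enat :=
  enat_min (range (fun i : int => recurrence_time_at w i l)).

(* l |-> (1 / l) * ln (phi l) in the extended reals: lne is the logarithm with
   lne 0 = -oo. The term at l = 0 is a junk value. *)
Definition log_growth (R : realType) (phi : nat -> R) (l : nat) : \bar R :=
  ((l%:R^-1)%:E * lne (phi l)%:E)%E.

(* Main.v *)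
(* Rosenfeld's counting method.  Call a finite word admissible if no factor of
   length l + 1 reappears at a distance s with 0 < s <= D l, where D l is about
   phi l for l >= l0 and 0 otherwise.  Among the one-letter extensions of the
   admissible words of length n, those that violate the condition for a given
   pair (l, s) are determined by an admissible word of length n - l.  Hence,
   writing c n for the number of admissible words of length n,
     k * c n <= c (n + 1) + \sum_(l < n) D l * c (n - l),
   and if \sum_l D l * b ^- l <= k - b, induction gives b * c n <= c (n + 1).
   Since phi l <= a ^ l eventually with a < k, any b strictly between a and k
   works once l0 is large.  An ultrafilter limit of admissible words of growing
   lengths, recentred, is the required biinfinite word. *)

Require Import Defs.
From HB Require Import structures.
From mathcomp Require Import all_boot all_order all_algebra.
From mathcomp Require Import all_classical all_reals all_analysis.
From mathcomp Require Import zify lra.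

Set Implicit Arguments.
Unset Strict Implicit.
Unset Printing Implicit Defensive.

Import Order.TTheory GRing.Theory Num.Theory.
Import numFieldNormedType.Exports.

Local Open Scope classical_set_scope.
Local Open Scope ring_scope.

Local Open Scope nat_scope.

(** * Finite admissible words and their returns *)

Definition returns (T : eqType) (l s : nat) (u : seq T) : bool :=
  (l + s < size u) && (take l.+1 u == take l.+1 (drop s u)).

(* Meant for size u = n + 1, where a return at distance s > 0 forces l < n. *)
Definition returns_early (T : eqType) (D : nat -> nat) (n : nat) (u : seq T) :
    bool :=
  [exists l : 'I_n, exists s : 'I_(D l), returns l s.+1 u].

Definition extensions (A : finType) (L : seq (seq A)) : seq (seq A) :=
  [seq a :: v | a <- enum A, v <- L].

(** Words grow on the left, so any violation created by a new letter involves a prefix; testing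
    prefixes at each length therefore controls all positions. *)
Fixpoint admissible (A : finType) (D : nat -> nat) (n : nat) : seq (seq A) :=
  if n is m.+1 then
    [seq u <- extensions (admissible A D m) | ~~ returns_early D m u]
  else [:: [::]].

Lemma admissible_cons (A : finType) (D : nat -> nat) (n : nat) (u : seq A) :
  u \in admissible A D n.+1 ->
  exists a v, [/\ u = a :: v, v \in admissible A D n & ~~ returns_early D n u].
Proof.
rewrite /= mem_filter => /andP[nu /allpairsP[[a v] /= [_ vL uE]]].
by exists a, v.
Qed.

Lemma size_admissible (A : finType) (D : nat -> nat) (n : nat) (u : seq A) :
  u \in admissible A D n -> size u = n.
Proof.
elim: n u => [|n IHn] u; first by rewrite inE => /eqP->.
by case/admissible_cons => a [v [-> /IHn <- _]].
Qed.

Lemma admissible_uniq (A : finType) (D : nat -> nat) (n : nat) :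
  uniq (admissible A D n).
Proof.
elim: n => //= n IHn; apply/filter_uniq/allpairs_uniq => //; first exact: enum_uniq.
by move=> [a v] [b w] _ _ /= [-> ->].
Qed.

Lemma admissible_drop (A : finType) (D : nat -> nat) (n j : nat) (u : seq A) :
  u \in admissible A D n -> j <= n -> drop j u \in admissible A D (n - j).
Proof.
elim: n j u => [|n IHn] [|j] u uL //; rewrite ?drop0 //.
case/admissible_cons: uL => a [v [-> vL _]] jn /=.
by rewrite subSS; exact: IHn.
Qed.

Lemma admissible_returns (A : finType) (D : nat -> nat) (n l s : nat)
    (u : seq A) :
  u \in admissible A D n -> 0 < s <= D l -> ~~ returns l s u.
Proof.
case: n => [|n] uL sD; first by move: uL; rewrite inE => /eqP->; rewrite /returns ltn0.
have su := size_admissible uL.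
case/admissible_cons: uL => a [v [_ _]]; apply: contra => rs.
have ln : l < n by case/andP: rs; rewrite su; lia.
case: s sD rs => // s /= sD rs.
by apply/existsP; exists (Ordinal ln); apply/existsP; exists (Ordinal sD).
Qed.

(* The first l + 1 letters are forced one by one, from right to left, by the
   letter s positions further. *)
Lemma returns_drop_inj (T : eqType) (l s : nat) (u v : seq T) :
  0 < s -> size u = size v -> returns l s u -> returns l s v ->
  drop l.+1 u = drop l.+1 v -> u = v.
Proof.
move=> s0 suv /andP[lu /eqP ru] /andP[lv /eqP rv] duv.
case: u => [//|x0 u'] in suv lu ru duv *; set u := x0 :: u' in suv lu ru duv *.
have shift (w : seq T) : take l.+1 w = take l.+1 (drop s w) ->
    forall i, i <= l -> nth x0 w i = nth x0 w (s + i).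
  by move=> rw i il; rewrite -(nth_take x0 (n0 := l.+1)) // rw nth_take // nth_drop.
apply: (@eq_from_nth _ x0) => // i _.
have [m] := ubnP (size u - i); elim: m i => // m IHm i im.
have [il|il] := leqP i l.
  by rewrite shift // (shift v) //; apply: IHm; lia.
by rewrite -(subnKC il) -!nth_drop duv.
Qed.

(** On the offending extensions [drop l.+1] is injective by [returns_drop_inj]. The dropped letters
    include the new one, so what is left is a suffix of an admissible word. *)
Lemma count_returns (A : finType) (D : nat -> nat) (n l s : nat) :
  0 < s -> l <= n ->
  count (returns l s) (extensions (admissible A D n)) <=
    size (admissible A D (n - l)).
Proof.
move=> s0 ln; rewrite -size_filter -(size_map (drop l.+1)).
have sE u : u \in extensions (admissible A D n) -> size u = n.+1.
  by case/allpairsP => -[a v] /= [_ /size_admissible <- ->].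
apply: uniq_leq_size.
  rewrite map_inj_in_uniq.
    apply/filter_uniq/allpairs_uniq; [exact: enum_uniq|exact: admissible_uniq|].
    by move=> [a v] [b w] _ _ /= [-> ->].
  move=> u v; rewrite !mem_filter => /andP[ru uE] /andP[rv vE].
  by apply: returns_drop_inj ru rv; rewrite // !sE.
move=> x /mapP[u]; rewrite mem_filter => /andP[_ /allpairsP[[a v] /= [_ vL ->]]] ->.
exact: admissible_drop.
Qed.

Lemma count_exists (T : Type) (I : finType) (P : I -> pred T) (s : seq T) :
  count (fun x => [exists i, P i x]) s <= \sum_i count (P i) s.
Proof.
elim: s => [|x s IHs] //=; rewrite big_split /= leq_add //.
by case: existsP => //= -[i Pi]; rewrite (bigD1 i) //= Pi.
Qed.

Lemma admissible_recurrence (A : finType) (D : nat -> nat) (n : nat) :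
  #|A| * size (admissible A D n) <=
  size (admissible A D n.+1) + \sum_(l < n) D l * size (admissible A D (n - l)).
Proof.
have <- : size (extensions (admissible A D n)) = #|A| * size (admissible A D n).
  by rewrite size_allpairs cardE.
rewrite -(count_predC (returns_early D n)) addnC /= size_filter leq_add2l.
apply: leq_trans (count_exists _ _) _; apply: leq_sum => l _.
apply: leq_trans (count_exists _ _) _.
rewrite -[X in _ <= X * _](card_ord (D l)) -sum_nat_const; apply: leq_sum => s _.
by apply: count_returns => //; exact: ltnW.
Qed.

(** * Exponential growth of the number of admissible words *)

Local Open Scope ring_scope.

Lemma admissible_growth (R : realFieldType) (A : finType) (D : nat -> nat)
    (b : R) (n : nat) :
  0 < b ->
  (forall m, \sum_(l < m) (D l)%:R * b ^- l <= #|A|%:R - b) ->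
  b * (size (admissible A D n))%:R <= (size (admissible A D n.+1))%:R.
Proof.
move=> b0 Db; elim/ltn_ind: n => n IHn.
set a := fun n => (size (admissible A D n))%:R : R.
(* Iterating the induction hypothesis from length [n] downwards bounds the earlier counts by the
   count at [n]. *)
have decay l : (l <= n)%N -> a (n - l)%N <= b ^- l * a n.
  elim: l => [|l IHl] ln; first by rewrite subn0 expr0 invr1 mul1r.
  apply: le_trans (_ : b ^-1 * a (n - l)%N <= _).
    have -> : (n - l = (n - l.+1).+1)%N by lia.
    by rewrite ler_pdivlMl //; apply: IHn; lia.
  by rewrite exprS invfM -mulrA ler_pM2l ?invr_gt0 // IHl // ltnW.
have : #|A|%:R * a n <= a n.+1 + \sum_(l < n) (D l)%:R * a (n - l)%N.
  rewrite /a; have := admissible_recurrence A D n.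
  rewrite -(ler_nat R) natrM natrD natr_sum.
  by under eq_bigr do rewrite natrM.
have : \sum_(l < n) (D l)%:R * a (n - l)%N <= (#|A|%:R - b) * a n.
  apply: le_trans (_ : (\sum_(l < n) (D l)%:R * b ^- l) * a n <= _).
    rewrite mulr_suml; apply: ler_sum => l _.
    by rewrite -mulrA ler_wpM2l // decay // ltnW.
  by rewrite ler_wpM2r // ler0n.
by rewrite /a; lra.
Qed.

Lemma admissible_nonempty (R : realFieldType) (A : finType) (D : nat -> nat)
    (b : R) (n : nat) :
  0 < b ->
  (forall m, \sum_(l < m) (D l)%:R * b ^- l <= #|A|%:R - b) ->
  exists u, u \in admissible A D n.
Proof.
move=> b0 Db.
suff: (0 < size (admissible A D n))%N.
  by case: (admissible A D n) => // u ? _; exists u; rewrite mem_head.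
elim: n => // n IHn; rewrite -(ltr_nat R).
by apply: lt_le_trans (admissible_growth _ b0 Db); rewrite mulr_gt0 // ltr0n.
Qed.

(** * Passage to biinfinite words *)

(** This is compactness of the product: along an ultrafilter each coordinate selects one letter, and
    finitely many coordinates agree with the limit simultaneously for arbitrarily large [N]. *)
Lemma ultrafilter_limit (T : eqType) (A : finType) (f : nat -> T -> A) :
  exists w : T -> A, forall (r : seq T) (M : nat),
    exists2 N, (M <= N)%N & {in r, f N =1 w}.
Proof.
have [U [ultraU ooU]] := ultraFilterLemma eventually_filter.
have /choice[w wU] : forall t, exists a, U [set N | f N t = a].
  move=> t; apply: contrapT => /forallNP noa.
  (* [A] is finite, so [U] would contain the set of those [N] for which [f N t] differs from every
     letter, which is empty. *)
  have /(filter_forall (F := U)) : forall a, U [set N | f N t <> a].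
    by move=> a; have [/noa|] := in_ultra_setVsetC [set N | f N t = a] ultraU.
  by move=> /filter_ex[N /(_ (f N t))].
exists w => r M.
have UM : U [set N | (M <= N)%N] by apply: ooU; exact: nbhs_infty_ge.
suff /(filterI UM)/filter_ex[N [MN fN]] : U [set N | {in r, f N =1 w}] by exists N.
elim: r => [|t r IHr]; first by apply: (filterE (F := U)) => N x; rewrite in_nil.
apply: (filterS _ (filterI (wU t) IHr)) => N /= [ft fr] x.
by rewrite inE => /predU1P[->//|/fr].
Qed.

Lemma bounded_return_word (R : realFieldType) (A : finType) (D : nat -> nat)
    (b : R) :
  0 < b ->
  (forall m, \sum_(l < m) (D l)%:R * b ^- l <= #|A|%:R - b) ->
  exists w : word A, forall (i : int) (l s : nat),
    (0 < s <= D l)%N -> subword w (i + s%:Z) l <> subword w i l.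
Proof.
move=> b0 Db.
have /card_gt0P[a0 _] : (0 < #|A|)%N.
  by rewrite -(ltr_nat R); have := Db 0%N; rewrite big_ord0; lra.
(* Length [2N] with the origin at index [N] lets every integer position fall inside [u N] for large
   [N]. *)
have /choice[u uL] := fun N => admissible_nonempty N.*2 b0 Db.
have [w wlim] :=
  ultrafilter_limit (fun N (i : int) => nth a0 (u N) (absz (i + N%:Z))).
exists w => i l s sD eqw.
(* This window covers both occurrences of the factor; the bound on [N] below makes it fit inside
   [u N]. *)
pose r := [seq i + j%:Z | j <- iota 0 (s + l).+1].
have [N MN fN] := wlim r (absz i + s + l).+1.
pose p := absz (i + N%:Z).
have pE : p%:Z = i + N%:Z by rewrite /p; lia.
have plt : (p + s + l < N.*2)%N by lia.
have uE j : (j <= s + l)%N -> nth a0 (u N) (p + j) = w (i + j%:Z).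
  move=> jsl; rewrite -fN; last by apply/mapP; exists j; rewrite // mem_iota; lia.
  by congr nth; lia.
have pN : (p <= N.*2)%N by lia.
(* [returns] only tests prefixes, hence the cut at [p]. *)
have /negP := admissible_returns (admissible_drop (uL N) pN) sD; apply.
have su := size_admissible (uL N).
have sd : (l + s < size (drop p (u N)))%N by rewrite size_drop su; lia.
rewrite /returns sd; apply/eqP.
apply: (@eq_from_nth _ a0).
  by rewrite !size_takel // !size_drop su; lia.
rewrite size_takel ?size_drop ?su; last by lia.
move=> j jl; rewrite !nth_take // !nth_drop uE; last by lia.
rewrite uE; last by lia.
have := congr1 (fun t => tnth t (Ordinal jl)) eqw; rewrite !tnth_mktuple /= => <-.
by congr w; lia.
Qed.

(** * Recurrence times, growth rate and choice of constants *)

Lemma enat_minP (S : set enat) (n : nat) :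
  enat_min S = Some n -> S (Some n).
Proof.
rewrite /enat_min; case: pselect => // exS [<-].
by case: ex_minnP => m /asboolP.
Qed.

Lemma le_recurrence_time (R : realType) (A : finType) (w : word A) (x : R)
    (l : nat) :
  (forall (i : int) (s : nat), (0 < s)%N -> s%:R < x ->
    subword w (i + s%:Z) l <> subword w i l) ->
  (x%:E <= enat_ereal R (recurrence_time w l))%E.
Proof.
move=> noret; case E: recurrence_time => [n|]; last by rewrite leey.
case/enat_minP: E => i _ /enat_minP[s [s0 eqw] [sn]].
rewrite -sn lee_fin leNgt; apply/negP => sx.
exact: noret s0 sx eqw.
Qed.

Lemma log_growth_lt (R : realType) (phi : nat -> R) (c : R) :
  cvgn (log_growth phi) -> (limn (log_growth phi) < c%:E)%E ->
  \forall l \near \oo, phi l <= expR c ^+ l.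
Proof.
move=> cphi limc.
have : \forall l \near \oo, (log_growth phi l < c%:E)%E.
  apply: (cphi [set y | (y < c%:E)%E]); apply: open_nbhs_nbhs; split => //.
  exact: open_ereal_lt_ereal.
apply: filterS2 (nbhs_infty_gt 0) => l l0.
rewrite /log_growth lte_pdivrMl ?ltr0n // -EFinM /=.
(* Where [phi l] vanishes, [lne] is [-oo] and the bound is trivial. *)
case: ifPn => [phi0 _|]; first by rewrite (le_trans phi0) // exprn_ge0 // expR_ge0.
rewrite -ltNge lte_fin => phi0 lnphi.
by rewrite -expRM_natl -[phi l]lnK ?posrE // ler_expR ltW.
Qed.

(** From [l0] on the terms are dominated by powers of [a / b < 1], so the sum is at most a geometric
    tail. *)
Lemma weighted_sum_small (R : realType) (phi : nat -> R) (a b e : R) (l1 : nat) :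
  (forall l, 0 <= phi l) -> 0 < a -> a < b -> 0 < e ->
  (forall l, (l1 <= l)%N -> phi l <= a ^+ l) ->
  exists l0 : nat, forall m,
    \sum_(l < m) (if (l0 <= l)%N then Num.truncn (phi l) else 0%N)%:R * b ^- l
      <= e.
Proof.
move=> phi0 a0 ab e0 phia.
have b0 : 0 < b := lt_trans a0 ab.
pose q := a / b.
have q0 : 0 < q by rewrite divr_gt0.
have q1 : q < 1 by rewrite ltr_pdivrMr // mul1r.
have nq1 : `|q| < 1 by rewrite gtr0_norm.
have q1' : 0 < 1 - q by rewrite subr_gt0.
(* The tail starting at [n] sums to [q ^+ n / (1 - q)]. *)
have [l2 _ ql2] : \forall n \near \oo, q ^+ n < e * (1 - q).
  have := cvg_geometric 1 nq1 => /cvgr_lt /(_ _ (mulr_gt0 e0 q1')).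
  by apply: filterS => n; rewrite /geometric /= mul1r.
pose l0 := maxn l1 l2; exists l0 => m.
(* The upper index is the maximum of [l0] and [m]; the sum is empty when [m <= l0]. *)
apply: le_trans (_ : \sum_(l0 <= l < l0 + (m - l0)) q ^+ l <= _); last first.
  rewrite geometric_partial_tail.
  apply: le_trans (geometric_le_lim _ _ q0 nq1) _; first by rewrite exprn_ge0 // ltW.
  rewrite ler_pdivrMr //; apply/ltW/ql2; exact: leq_maxr.
have term l : (if (l0 <= l)%N then Num.truncn (phi l) else 0%N)%:R * b ^- l <=
    if (l0 <= l)%N then q ^+ l else 0.
  case: ifPn => l0l; last by rewrite mul0r.
  rewrite /q expr_div_n ler_pM2r ?invr_gt0 ?exprn_gt0 //.
  apply: (le_trans _ (phia _ _)); first by rewrite truncn_le.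
  by apply: leq_trans l0l; exact: leq_maxl.
apply: le_trans (_ : \sum_(l < m) (if (l0 <= l)%N then q ^+ l else 0) <= _).
  by apply: ler_sum => l _; exact: term.
rewrite -(big_mkord xpredT (fun l => if (l0 <= l)%N then q ^+ l else 0)).
rewrite -big_mkcond /= -(big_nat_widenl _ _ _ xpredT) //.
have [ml|lm] := leqP m l0; first by rewrite !big_geq //; lia.
by rewrite subnKC // ltnW.
Qed.

Theorem theorem1p1 (R : realType) (k : nat) (hk : (2 <= k)%N)
    (phi : nat -> R) (phi_ge0 : forall l : nat, 0 <= phi l)
    (phi_ndecr : nondecreasing_seq phi)
    (delta : R) (delta_gt0 : 0 < delta) (delta_lt1 : delta < 1)
    (phi_cvg : cvgn (log_growth phi))
    (phi_lim : (limn (log_growth phi) <= (delta * ln k%:R)%:E)%E) :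
  exists l0 : nat, forall A : finType, #|A| = k ->
    exists w : word A, forall l : nat, (l0 <= l)%N ->
      ((phi l)%:E <= enat_ereal R (recurrence_time w l))%E.
Proof.
have lnk : 0 < ln (k%:R : R) by rewrite ln_gt0 // ltr1n.
(* Since [delta < 1], [c] lies strictly between [delta * ln k] and [ln k], which gives slack in the
   limit and keeps [expR c] below [k]. *)
pose c := (delta + 1) / 2 * ln k%:R : R.
have limc : (limn (log_growth phi) < c%:E)%E.
  by apply: le_lt_trans phi_lim _; rewrite lte_fin ltr_pM2r //; lra.
have [l1 _ phia] := log_growth_lt phi_cvg limc.
have a0 := expR_gt0 c; set a := expR c in phia a0.
have ak : a < k%:R.
  rewrite -[k%:R](lnK) ?posrE ?ltr0n; last by lia.
  by rewrite ltr_expR gtr_pMl //; lra.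
pose b := (a + k%:R) / 2.
have ab : a < b by rewrite /b; lra.
have b0 : 0 < b := lt_trans a0 ab.
have e0 : 0 < k%:R - b by rewrite /b; lra.
have [l0 Dsum] := weighted_sum_small phi_ge0 a0 ab e0 phia.
(* [l0] is fixed before the alphabet, which enters only through its cardinality. *)
exists l0 => A cardA; rewrite -cardA in Dsum.
have [w wP] := bounded_return_word
  (D := fun l => if (l0 <= l)%N then Num.truncn (phi l) else 0%N) b0 Dsum.
exists w => l l0l; apply: le_recurrence_time => i s s0 sphi.
by apply: wP; rewrite s0 l0l truncn_ge_nat // ltW.
Qed.
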